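(* Let $\lambda\in\mathbb R$, let $u=[u_1,\dots,u_n]:\mathbb R^d\to\mathbb R^d$ with $u_i\in C^1(\mathbb R^d;\mathbb R^{d_i})$, and define $$v[\rho]=-\Big[\int u_1(x)\,\mathrm d\rho_{-1}(x_{-1}),\ \dots,\ \int u_n(x)\,\mathrm d\rho_{-n}(x_{-n})\Big].$$ Then $u$ is $\lambda$-monotone (in the finite-dimensional sense) if and only if the velocity field $v$ is $\lambda$-monotone in $\overline{\mathcal P}_2$.
   Context: Fix $n\ge 1$ and dimensions $d_1,\dots,d_n$, $d=\sum_{i=1}^n d_i$; write $x=[x_1,\dots,x_n]\in\mathbb R^d$ with $x_i\in\mathbb R^{d_i}$, and $x_{-i}$ for all components except $x_i$. $\mathcal P_2(\mathbb R^k)$ is the set of Borel probability measures on $\mathbb R^k$ with finite second moment, $\mathscr W_2$ is the Wasserstein-2 metric, $\overline{\mathcal P}_2=\mathcal P_2(\mathbb R^{d_1})\times\cdots\times\mathcal P_2(\mathbb R^{d_n})$, with elements $\rho=[\rho_1,\dots,\rho_n]$, and $\overline{\mathscr W}_2(\rho,\mu)^2=\sum_{i=1}^n\mathscr W_2(\rho_i,\mu_i)^2$. $\mathrm d\rho_{-i}(x_{-i})=\prod_{j\ne i}\mathrm d\rho_j(x_j)$, so the $i$-th component $v_i[\rho](x_i)=-\int u_i(x)\,\mathrm d\rho_{-i}(x_{-i})$ is a function of $x_i\in\mathbb R^{d_i}$, and $v[\rho](x)=[v_1[\rho](x_1),\dots,v_n[\rho](x_n)]$. $\Gamma_i^*(\rho_i,\mu_i)$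 is the set of optimal couplings (for the cost $\|x_i-y_i\|^2$) of $\rho_i$ and $\mu_i$; $\Gamma^*(\rho,\mu)=\prod_i\Gamma_i^*(\rho_i,\mu_i)$, with $(\gamma_1,\dots,\gamma_n)$ identified with the product measure $\mathrm d\gamma(x,y)=\prod_i\mathrm d\gamma_i(x_i,y_i)$. Finite-dimensional $\lambda$-monotonicity of $u$: $\langle u(x)-u(x'),x-x'\rangle\ge\lambda\|x-x'\|^2$ for all $x,x'\in\mathbb R^d$ (first-order form); or, with $J(x)=\nabla u(x)\in\mathbb R^{d\times d}$, $J(x)+J(x)^\top\succeq2\lambda I_d$ for all $x\in\mathbb R^d$ (second-order form). $\lambda$-monotonicity of $v$ in $\overline{\mathcal P}_2$: for any $\rho^{(0)},\rho^{(1)}\in\overline{\mathcal P}_2$ and all $\gamma\in\Gamma^*(\rho^{(0)},\rho^{(1)})$, $$-\int\langle x-y,v[\rho^{(0)}](x)-v[\rho^{(1)}](y)\rangle\,\mathrm d\gamma(x,y)\ge\lambda\int\|x-y\|^2\,\mathrm d\gamma(x,y)=\lambda\,\overline{\mathscr W}_2(\rho^{(0)},\rho^{(1)})^2.$$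
   Formalization: Monotonicity of v is required only for those ρ⁰, ρ¹, γ where the integrals defining v[ρ⁰], v[ρ¹] converge absolutely a.e. and the negative part of each ⟨x_i−y_i, u_i(x)−u_i(y)⟩ is γ-integrable; for merely C¹ u, v may be undefined or the claim may fail otherwise. *)

(* Defs.v *)
From HB Require Import structures.
From mathcomp Require Import all_boot all_order all_algebra.
From mathcomp Require Import all_classical all_reals all_analysis.
From mathcomp Require Import measurable_realfun.

Set Implicit Arguments.
Unset Strict Implicit.
Unset Printing Implicit Defensive.

Import Order.TTheory GRing.Theory Num.Theory.
Import numFieldNormedType.Exports.

Local Open Scope classical_set_scope.
Local Open Scope ring_scope.

Definition pi_display {I : Type} : (I -> measure_display) -> measure_display.
Proof. by move=> _; exact: default_measure_display. Qed.

Section product_space.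
Context {I : finType} {d : I -> measure_display}.
Variable T : forall i, measurableType (d i).

Definition pi_space : Type := forall i, T i.

Definition pi_cylinders : set (set pi_space) :=
  \bigcup_(i in [set: I])
    preimage_set_system [set: pi_space] (fun x => x i) measurable.

HB.instance Definition _ := Pointed.copy pi_space (forall i, T i).
HB.instance Definition _ := @isMeasurable.Build (pi_display d) pi_space
  <<s pi_cylinders >> (@sigma_algebra0 _ setT pi_cylinders)
  (@sigma_algebraC _ pi_cylinders)
  (@sigma_algebra_bigcup _ setT pi_cylinders).

Lemma measurable_coord i : measurable_fun [set: pi_space] (fun x => x i).
Proof.
move=> _ A mA; rewrite setTI; apply: sub_sigma_algebra.
by exists i => //; exists A => //; rewrite setTI.
Qed.

Lemma measurable_to_pi d' (S : measurableType d') (f : S -> pi_space) :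
  (forall i, measurable_fun [set: S] (fun s => f s i)) ->
  measurable_fun [set: S] f.
Proof.
move=> mf.
apply: (@measurability _ _ S pi_space _ _ pi_cylinders erefl).
move=> _ [_ [i _ [A mA <-]] <-].
by rewrite !setTI; have := mf i measurableT _ mA; rewrite setTI.
Qed.

Definition update_coord i (p : pi_space * T i) : pi_space := dfwith p.1 i p.2.

Lemma measurable_update_coord i :
  measurable_fun [set: pi_space * T i] (@update_coord i).
Proof.
apply: measurable_to_pi => j.
have [ij|ij] := eqVneq i j.
  case: j / ij.
  apply: (eq_measurable_fun snd) => [p _|]; last exact: measurable_snd.
  by rewrite /update_coord dfwithin.
apply: (eq_measurable_fun (fun p : pi_space * T i => p.1 j)) => [p _|].
  by rewrite /update_coord dfwithout.
exact: measurableT_comp (@measurable_coord j) measurable_fst.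
Qed.

HB.instance Definition _ i := isMeasurableFun.Build _ _ _ _ _
  (@measurable_update_coord i).

Context {R : realType}.
Variable P : forall i, probability (T i) R.

(* Coordinates are resampled one after the other, starting from an arbitrary
   point; once all of them are, the law is the product measure: see
   [pi_prob_box]. *)
Fixpoint pi_prob_rec (s : seq I) : probability pi_space R :=
  if s is i :: s' then
    distribution (pi_prob_rec s' \x P i)%E (@update_coord i)
  else dirac (point : pi_space).

Definition pi_prob := pi_prob_rec (enum I).

Lemma pi_prob_rec_box (s : seq I) (A : forall i, set (T i)) : uniq s ->
  (forall i, measurable (A i)) ->
  (forall i, i \notin s -> A i point) ->
  pi_prob_rec s [set x | forall i, A i (x i)] = (\prod_(i <- s) P i (A i))%E.
Proof.
elim: s A => [|i s IH] A /=.
  move=> _ mA Apt; rewrite big_nil diracE mem_set//.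
  by move=> i; exact: Apt.
move=> /andP[iNs us] mA Apt; rewrite big_cons.
rewrite /distribution /pushforward.
pose A' j := if j == i then [set: T j] else A j.
rewrite (_ : _ @^-1` _ = [set x : pi_space | forall j, A' j (x j)] `*` A i).
  rewrite product_measure1E//.
  - rewrite muleC; congr (_ * _)%E.
    transitivity (\prod_(j <- s) P j (A' j))%E.
      apply: IH => // j; rewrite /A'; first by case: eqP.
      by case: eqP => // /eqP ji js; apply: Apt; rewrite in_cons negb_or ji.
    rewrite big_seq [RHS]big_seq; apply: eq_bigr => j js; rewrite /A'.
    by case: eqP => // ji; rewrite -ji js in iNs.
  - rewrite (_ : mkset _ = \bigcap_(j in [set: I]) (fun x : pi_space => x j) @^-1` A' j).
      apply: fin_bigcap_measurable => // j _; rewrite -[X in measurable X]setTI.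
      apply: measurable_coord => //; rewrite /A'; case: eqP => // _; exact: measurableT.
    by apply/seteqP; split => [x xA j _|x xA j]; exact: xA.
apply/seteqP; split => [[x t] /= xA|[x t] /= [xA At] j].
  split=> [j|]; last by have := xA i; rewrite /update_coord dfwithin.
  rewrite /A'; case: eqP => // /eqP ji.
  by have := xA j; rewrite /update_coord dfwithout// eq_sym.
have [<-|ij] := eqVneq i j; first by rewrite /update_coord dfwithin.
rewrite /update_coord dfwithout//; have := xA j.
by rewrite /A' eq_sym (negbTE ij).
Qed.

Lemma pi_prob_box (A : forall i, set (T i)) : (forall i, measurable (A i)) ->
  pi_prob [set x | forall i, A i (x i)] = (\prod_i P i (A i))%E.
Proof.
move=> mA; rewrite /pi_prob pi_prob_rec_box ?enum_uniq//.
  by rewrite big_enum.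
by move=> i; rewrite mem_enum.
Qed.

End product_space.

Section glue.
Context {I : finType} (T : I -> Type) (i : I).

Definition glue (xi : T i) (z : forall j : {j | j != i}, T (val j)) :
    forall j, T j :=
  fun j => match eq_comparable j i with
    | left ji => eq_rect_r T xi ji
    | right nji => z (exist _ j (introN eqP nji))
    end.

Lemma glue_in xi z : glue xi z i = xi.
Proof.
rewrite /glue; case: eq_comparable => // ii.
by rewrite (_ : ii = erefl)//; exact: eq_irrelevance.
Qed.

Lemma glue_out xi z (j : {j | j != i}) : glue xi z (val j) = z j.
Proof.
rewrite /glue; case: j => j ji /=; case: eq_comparable => [e|n].
  by exfalso; rewrite e eqxx in ji.
by congr (z (exist _ j _)); exact: eq_irrelevance.
Qed.

End glue.

Section euclidean.
Context {R : realType}.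

(* The library's norm on row vectors is the sup norm, so the Euclidean
   structure is introduced by hand. *)
Definition dotv k (x y : 'rV[R]_k) : R := \sum_i x 0 i * y 0 i.
Definition sqnorm k (x : 'rV[R]_k) : R := dotv x x.

Definition possemidef k (A : 'M[R]_k) : Prop :=
  forall w : 'rV[R]_k, 0 <= dotv (w *m A) w.

Definition borel k : measurableType _ := g_sigma_algebraType (@open 'rV[R]_k).

Definition C1 m k (f : 'rV[R]_m -> 'rV[R]_k) : Prop :=
  (forall x, differentiable f x) /\ continuous (jacobian f).

End euclidean.
Arguments borel : clear implicits.

Section wasserstein.
Context {R : realType} {k : nat}.
Implicit Types (rho mu : probability (borel R k) R).
Implicit Type gamma : probability (borel R k * borel R k)%type R.
Local Open Scope ereal_scope.

Definition finite_second_moment rho : Prop :=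
  \int[rho]_x (sqnorm (x : 'rV_k))%:E < +oo.

Definition coupling rho mu gamma : Prop :=
  (forall A, measurable A -> gamma (fst @^-1` A) = rho A) /\
  (forall A, measurable A -> gamma (snd @^-1` A) = mu A).

Definition transport_cost gamma : \bar R :=
  \int[gamma]_p (sqnorm ((p.1 : 'rV_k) - p.2)%R)%:E.

(* the square of the Wasserstein-2 distance *)
Definition W2sq rho mu : \bar R :=
  ereal_inf [set transport_cost gamma | gamma in coupling rho mu].

Definition optimal_coupling rho mu gamma : Prop :=
  coupling rho mu gamma /\ transport_cost gamma = W2sq rho mu.

End wasserstein.

Section monotonicity.
Context {R : realType} {n : nat} (dim : 'I_n -> nat).

Local Notation D := (\sum_(i < n) dim i)%N.

Definition vec (x : forall i, 'rV[R]_(dim i)) : 'rV[R]_D := \mxrow_i x i.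

Definition monotone1 (lambda : R) (f : 'rV[R]_D -> 'rV[R]_D) : Prop :=
  forall x y, lambda * sqnorm (x - y) <= dotv (f x - f y) (x - y).

(* [jacobian] acts on row vectors, i.e. it is the transpose of the usual
   Jacobian matrix; the symmetrized matrix is the same. *)
Definition monotone2 (lambda : R) (f : 'rV[R]_D -> 'rV[R]_D) : Prop :=
  forall x, possemidef (jacobian f x + (jacobian f x)^T - (2 * lambda)%:M).

Variable u : forall i, 'rV[R]_D -> 'rV[R]_(dim i).

Definition ufield (x : 'rV[R]_D) : 'rV[R]_D := vec (fun i => u i x).

Section velocity.
Variable rho : forall i, probability (borel R (dim i)) R.

Definition rho_minus i := pi_prob (fun j : {j | j != i} => rho (val j)).

Definition slice i (xi : borel R (dim i))
    (z : pi_space (fun j : {j | j != i} => borel R (dim (val j)))) :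
    'rV[R]_(dim i) :=
  u i (vec (glue (T := fun j => 'rV[R]_(dim j)) xi z)).

Definition velocity_comp i (xi : 'rV[R]_(dim i)) : 'rV[R]_(dim i) :=
  \row_k - \int[rho_minus i]_z (slice xi z 0 k).

Definition velocity (x : 'rV[R]_D) : 'rV[R]_D :=
  vec (fun i => velocity_comp (submxrow x i)).

(* The integrals defining v[rho](x_i) converge absolutely for rho_i-almost
   every x_i. *)
Definition velocity_defined : Prop := forall i,
  {ae rho i, forall xi, forall k : 'I_(dim i),
    (rho_minus i).-integrable setT (fun z => (slice xi z 0 k)%:E)}.

End velocity.

Section pairing.
Variable gamma : forall i, probability (borel R (dim i) * borel R (dim i))%type R.

Local Notation pair_space :=
  (pi_space (fun i => (borel R (dim i) * borel R (dim i))%type)).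

Definition xs (z : pair_space) : 'rV[R]_D := vec (fun i => (z i).1).
Definition ys (z : pair_space) : 'rV[R]_D := vec (fun i => (z i).2).

Definition pairing i (z : pair_space) : R :=
  dotv ((z i).1 - (z i).2 : 'rV[R]_(dim i)) (u i (xs z) - u i (ys z)).

(* Without this condition the iterated integrals over rho_{-i}, then gamma_i,
   need not be exchangeable, and a monotone u may have a velocity field that is
   defined everywhere but violates the inequality below. It holds in particular
   if u is square integrable for both product measures. *)
Definition pairing_defined : Prop := forall i,
  (\int[pi_prob gamma]_z (fun z => (pairing i z)%:E)^\- z < +oo)%E.

End pairing.

(* As u is only C^1, v[rho] does not exist for every rho: the inequality is
   required wherever both sides make sense. The left-hand side here is
   lambda times the squared Wasserstein distance by [integral_sqdist]. *)
Definition velocity_monotone (lambda : R) : Prop :=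
  forall (rho0 rho1 : forall i, probability (borel R (dim i)) R)
    (gamma : forall i, probability (borel R (dim i) * borel R (dim i))%type R),
  (forall i, finite_second_moment (rho0 i)) ->
  (forall i, finite_second_moment (rho1 i)) ->
  velocity_defined rho0 -> velocity_defined rho1 ->
  (forall i, optimal_coupling (rho0 i) (rho1 i) (gamma i)) ->
  pairing_defined gamma ->
  (lambda%:E * \int[pi_prob gamma]_z (sqnorm (xs z - ys z))%:E <=
   - \int[pi_prob gamma]_z
       (dotv (xs z - ys z)
             (velocity rho0 (xs z) - velocity rho1 (ys z)))%:E)%E.

End monotonicity.

Lemma pi_prob_coord (I : finType) (d : I -> measure_display)
    (T : forall i, measurableType (d i)) (R : realType)
    (P : forall i, probability (T i) R) i (A : set (T i)) : measurable A ->
  pi_prob P ((fun x => x i) @^-1` A) = P i A.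
Proof.
move=> mA.
pose B j : set (T j) := [set t | forall e : j = i, A (eq_rect _ T t _ e)].
have BT j : j != i -> B j = setT.
  move=> /eqP ji; apply/seteqP; split=> // t _ e; by [].
have Bi : B i = A.
  apply/seteqP; split=> t; first by move=> /(_ erefl).
  by move=> At e; rewrite (_ : e = erefl)//; exact: eq_irrelevance.
rewrite (_ : _ @^-1` _ = [set x | forall j, B j (x j)]); last first.
  apply/seteqP; split=> x /=; last by move=> /(_ i); rewrite Bi.
  move=> Ax j; have [ji|ji] := eqVneq j i; last by rewrite BT.
  by case: i / ji A mA B BT Bi Ax => A mA B BT Bi Ax; rewrite Bi.
rewrite pi_prob_box; last first.
  move=> j; have [ji|ji] := eqVneq j i; last by rewrite BT.
  by rewrite ji Bi.
rewrite (bigD1 i)//= Bi big1 ?mule1// => j ji.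
by rewrite BT// probability_setT.
Qed.

Lemma ge0_integral_pi_coord (I : finType) (d : I -> measure_display)
    (T : forall i, measurableType (d i)) (R : realType)
    (P : forall i, probability (T i) R) i (f : T i -> \bar R) :
  measurable_fun [set: T i] f -> (forall t, 0 <= f t)%E ->
  (\int[pi_prob P]_x f (x i) = \int[P i]_t f t)%E.
Proof.
move=> mf f0.
have mc := @measurable_coord _ _ T i.
transitivity (\int[pushforward (pi_prob P) (fun x : pi_space T => x i)]_t f t)%E.
  by rewrite ge0_integral_pushforward// => t; rewrite inE.
apply: eq_measure_integral => A mA _.
exact: pi_prob_coord.
Qed.

Section coords.
Context {R : realType} {k : nat}.

Lemma measurable_entry (j : 'I_k) :
  measurable_fun [set: borel R k] (fun x : 'rV[R]_k => x 0 j).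
Proof.
apply: (measurability _ (RGenOpens.measurableE R)).
move=> _ [_ [a [b ->]] <-]; rewrite setTI.
apply: sub_sigma_algebra => /=.
apply: open_comp => //.
by move=> x _; exact: coord_continuous.
Qed.

Lemma measurable_sqdist : measurable_fun [set: borel R k * borel R k]
  (fun p : 'rV[R]_k * 'rV[R]_k => (sqnorm (p.1 - p.2))%:E).
Proof.
apply/measurable_EFinP; rewrite /sqnorm /dotv.
apply: measurable_sum => j.
have m : measurable_fun [set: borel R k * borel R k]
    (fun p : 'rV[R]_k * 'rV[R]_k => (p.1 - p.2) 0 j).
  under eq_fun do rewrite !mxE.
  apply: measurable_funB.
    exact: (measurableT_comp (measurable_entry j) measurable_fst).
  exact: (measurableT_comp (measurable_entry j) measurable_snd).
exact: measurable_funM.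
Qed.

Lemma sqnorm_ge0 (x : 'rV[R]_k) : 0 <= sqnorm x.
Proof. by apply: sumr_ge0 => i _; rewrite -expr2 sqr_ge0. Qed.

End coords.

Section equality.
Context {R : realType} {n : nat} (dim : 'I_n -> nat).

Lemma sqnorm_vec (x y : forall i, 'rV[R]_(dim i)) :
  sqnorm (vec x - vec y) = \sum_i sqnorm (x i - y i).
Proof.
have dE k (a b : 'rV[R]_k) : dotv a b = (a *m b^T) 0 0.
  by rewrite mxE; apply: eq_bigr => j _; rewrite mxE.
rewrite /sqnorm dE /vec -mxrowB tr_mxrow mul_mxrow_mxcol summxE.
by apply: eq_bigr => i _; rewrite dE.
Qed.

Lemma integral_sqdist (rho0 rho1 : forall i, probability (borel R (dim i)) R)
    (gamma : forall i, probability (borel R (dim i) * borel R (dim i))%type R) :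
  (forall i, optimal_coupling (rho0 i) (rho1 i) (gamma i)) ->
  (\int[pi_prob gamma]_z (sqnorm (xs z - ys z))%:E =
   \sum_i W2sq (rho0 i) (rho1 i))%E.
Proof.
move=> og.
under eq_integral do rewrite sqnorm_vec -sumEFin.
rewrite ge0_integral_sum//; first last.
- by move=> i z _; rewrite lee_fin sqnorm_ge0.
- by move=> i; exact: (measurableT_comp (@measurable_sqdist _ _) (@measurable_coord _ _ _ i)).
apply: eq_bigr => i _; rewrite -(og i).2 /transport_cost.
apply: (@ge0_integral_pi_coord _ _ _ _ gamma i (fun p => (sqnorm ((p.1 : 'rV_(dim i)) - p.2))%:E)).
  exact: measurable_sqdist.
by move=> t; rewrite lee_fin sqnorm_ge0.
Qed.
End equality.

(* Main.v *)
Require Import Defs.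
From HB Require Import structures.
From mathcomp Require Import all_boot all_order all_algebra.
From mathcomp Require Import all_classical all_reals all_analysis.
From mathcomp Require Import measurable_realfun.
From mathcomp Require Import ring lra.
Import Order.TTheory GRing.Theory Num.Theory.
Import numFieldNormedType.Exports.
Local Open Scope classical_set_scope.
Local Open Scope ring_scope.

(** A field on a finite-dimensional space is [lambda]-monotone when, along
    every line with direction [w], its component [<f, w>] grows at least at
    rate [lambda * |w|^2]. By the mean value theorem one way and a limit of
    difference quotients the other way, this is a lower bound on the quadratic
    form of the Jacobian ([monotone12]), so only the first-order form has to be
    compared with the velocity field.

    Let [z = (x, y)] be drawn from the product of the couplings and write
    [g_i z = <x_i - y_i, u_i x - u_i y>]. Monotonicity of [u] says
    [lambda * |x - y|^2 <= \sum_i g_i z]. Averaging [g_i] over all coordinates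
    other than [i] turns [u_i x] into [- v_i[rho0] x_i] and [u_i y] into
    [- v_i[rho1] y_i], because the marginals of the remaining couplings
    are the remaining [rho0_j] and [rho1_j]; by Fubini the averaging does not
    change the integral of [g_i], and the desired inequality is the integral of
    the pointwise one ([velocity_monotone_of_monotone1]). Integrability needs
    care: the hypotheses only make the negative parts of the [g_i] integrable,
    so [g_i] is split into its positive and negative parts, Tonelli is applied
    to each of them, and the identities are compared as equalities between
    integrals of nonnegative functions, in which only finite terms are cancelled
    ([le_integral_averaged]). Fubini for the product law is obtained from its
    characterization by the measure of boxes ([pi_prob_unique]).

    Conversely, on Dirac masses at the components of [x] and of [y] the velocity
    field is [- u] and the Dirac mass at the pair is an optimal coupling, since
    every coupling is concentrated there. The Wasserstein inequality is then
    literally the finite-dimensional one ([monotone1_of_velocity_monotone]). *)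

Set Implicit Arguments.
Unset Strict Implicit.
Unset Printing Implicit Defensive.

(** * Dot products and quadratic forms *)

Section dot_product.
Context {R : realType} {k : nat}.
Implicit Types (x y z : 'rV[R]_k) (a : R).

Lemma dotvDl x y z : dotv (x + y) z = dotv x z + dotv y z.
Proof.
by rewrite -big_split; apply: eq_bigr => j _; rewrite mxE mulrDl.
Qed.

Lemma dotvZl a x y : dotv (a *: x) y = a * dotv x y.
Proof. by rewrite mulr_sumr; apply: eq_bigr => j _; rewrite mxE mulrA. Qed.

Lemma dotvC x y : dotv x y = dotv y x.
Proof. by apply: eq_bigr => j _; rewrite mulrC. Qed.

Lemma dotvZr a x y : dotv x (a *: y) = a * dotv x y.
Proof. by rewrite dotvC dotvZl dotvC. Qed.

Lemma dotvNl x y : dotv (- x) y = - dotv x y.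
Proof. by rewrite -scaleN1r dotvZl mulN1r. Qed.

Lemma dotvNr x y : dotv x (- y) = - dotv x y.
Proof. by rewrite -scaleN1r dotvZr mulN1r. Qed.

Lemma dotvBl x y z : dotv (x - y) z = dotv x z - dotv y z.
Proof. by rewrite dotvDl dotvNl. Qed.

Lemma dotvE x y : dotv x y = (x *m y^T) 0 0.
Proof. by rewrite mxE; apply: eq_bigr => j _; rewrite mxE. Qed.

Lemma sqnormZ a x : sqnorm (a *: x) = a ^+ 2 * sqnorm x.
Proof. by rewrite /sqnorm dotvZl dotvZr mulrA. Qed.

Lemma dotv_mulmx_tr (A : 'M[R]_k) x : dotv (x *m A^T) x = dotv (x *m A) x.
Proof. by rewrite [RHS]dotvC !dotvE trmx_mul mulmxA. Qed.

Lemma continuous_dotv z : continuous (fun x => dotv x z).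
Proof.
apply: continuous_big => [|j _ x]; first exact: add_continuous.
by apply: (@cvgM _ _ (nbhs x));
  [exact: coord_continuous|exact: cvg_cst].
Qed.

(** Only the symmetric part of the matrix enters a quadratic form, so the
    matrix inequality for the symmetrized Jacobian bounds the Jacobian's own
    quadratic form. *)
Lemma possemidef_symmetrizedP (lambda : R) (A : 'M[R]_k) :
  possemidef (A + A^T - (2 * lambda)%:M) <->
  forall x, lambda * sqnorm x <= dotv (x *m A) x.
Proof.
suff E x : dotv (x *m (A + A^T - (2 * lambda)%:M)) x =
    2 * (dotv (x *m A) x - lambda * sqnorm x).
  by split=> H x; move: (H x); rewrite E pmulr_rge0// subr_ge0.
rewrite mulmxBr mulmxDr dotvBl dotvDl dotv_mulmx_tr mul_mx_scalar dotvZl.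
by rewrite /sqnorm; lra.
Qed.

End dot_product.

(** * First- and second-order monotonicity *)

Section first_and_second_order.
Context {R : realType} {k : nat}.
Implicit Types (f : 'rV[R]_k -> 'rV[R]_k).

Lemma cvg_dotv_quotient f x w : differentiable f x ->
  (fun h : R => dotv (h^-1 *: (f (h *: w + x) - f x)) w) @ 0^' -->
  dotv (w *m jacobian f x) w.
Proof.
move=> df; rewrite -deriveEjacobian//.
have cv : (fun h => h^-1 *: (f (h *: w + x) - f x)) @ 0^' --> 'D_w f x.
  exact: (@diff_derivable _ _ _ _ _ _ df).
apply: (@cvg_comp _ _ _ _ (fun v => dotv v w) _ _ _ cv).
exact: continuous_dotv.
Qed.

(** Monotonicity between [x] and [h *: w + x] bounds from below the difference
    quotient of [f] at [x], paired with [w]: its factor [h ^+ 2] cancels, so the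
    sign of [h] does not matter. *)
Lemma dotv_jacobian_ge lambda f x w :
  (forall y z, lambda * sqnorm (y - z) <= dotv (f y - f z) (y - z)) ->
  differentiable f x ->
  lambda * sqnorm w <= dotv (w *m jacobian f x) w.
Proof.
move=> mf df; apply: (cvgr_to_ge (@cvg_dotv_quotient _ _ w df)).
near=> h.
have h0 : h != 0 by near: h; exact: nbhs_dnbhs_neq.
have := mf (h *: w + x) x; rewrite addrK sqnormZ dotvZr dotvZl => H.
have h2 : 0 < h ^+ 2 by rewrite exprn_even_gt0.
rewrite -(ler_pM2l h2) mulrCA; apply: le_trans H _.
by rewrite mulrA expr2 mulfK.
Unshelve. all: by end_near. Qed.

Lemma is_derive_dotv_line f x w (t : R) :
  (forall y, differentiable f y) ->
  is_derive t 1 (fun s : R => dotv (f (s *: w + x)) w)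
    (dotv (w *m jacobian f (t *: w + x)) w).
Proof.
move=> df.
have H : (fun h : R => h^-1 *: (dotv (f ((h *: 1 + t) *: w + x)) w -
    dotv (f (t *: w + x)) w)) @ 0^' --> dotv (w *m jacobian f (t *: w + x)) w.
  under eq_fun => h do rewrite [h *: 1]mulr1 scalerDl -addrA -dotvBl
    -[_ *: _]dotvZl.
  exact: cvg_dotv_quotient.
by apply: DeriveDef; [apply/cvg_ex; eexists; exact: H|exact: cvg_lim H].
Qed.

(** The mean value theorem for [f], paired with [x - y], on the segment from
    [y] to [x]. *)
Lemma monotone_of_jacobian lambda f x y :
  (forall z, differentiable f z) ->
  (forall z w, lambda * sqnorm w <= dotv (w *m jacobian f z) w) ->
  lambda * sqnorm (x - y) <= dotv (f x - f y) (x - y).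
Proof.
move=> df Jf; set w := x - y.
have dh t := is_derive_dotv_line y w t df.
have [|c _] := @MVT R _ _ 0 1 ltr01 (fun t _ => dh t).
  by apply: derivable_within_continuous => t _; have [] := dh t.
rewrite scale1r scale0r add0r /w subrK -/w subr0 mulr1 -dotvBl => ->.
exact: Jf.
Qed.

End first_and_second_order.

Section ufield.
Context {R : realType} {n : nat} (dim : 'I_n -> nat).
Local Notation D := (\sum_(i < n) dim i)%N.
Variable u : forall i, 'rV[R]_D -> 'rV[R]_(dim i).

Lemma vec_entry (x : forall i, 'rV[R]_(dim i)) (j : 'I_D) :
  vec x 0 j = x (tagnat.sig1 j) 0 (tagnat.sig2 j).
Proof. by rewrite /vec mxE. Qed.

Lemma dotv_vec (x y : forall i, 'rV[R]_(dim i)) :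
  dotv (vec x) (vec y) = \sum_i dotv (x i) (y i).
Proof.
rewrite dotvE /vec tr_mxrow mul_mxrow_mxcol summxE.
by apply: eq_bigr => i _; rewrite dotvE.
Qed.

Lemma vecB (x y : forall i, 'rV[R]_(dim i)) :
  vec x - vec y = vec (fun i => x i - y i).
Proof. by rewrite /vec mxrowB. Qed.

Lemma differentiable_ufield x : (forall i, differentiable (u i) x) ->
  differentiable (ufield u) x.
Proof.
move=> du.
(* Decomposing on the canonical basis reduces differentiability of [ufield u]
   to that of its scalar entries. *)
rewrite (_ : ufield u = \sum_(j < D)
    (fun y => u (tagnat.sig1 j) y 0 (tagnat.sig2 j) *:
              (delta_mx 0 j : 'rV[R]_D))).
  apply: differentiable_sum => j; apply: differentiableZl.
  apply: (@differentiable_comp _ _ _ _ (u (tagnat.sig1 j))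
    (fun v : 'rV[R]_(dim (tagnat.sig1 j)) => v 0 (tagnat.sig2 j))) => //.
  exact: differentiable_coord.
apply/funext => y; rewrite fct_sumE [LHS]row_sum_delta.
by apply: eq_bigr => j _; rewrite vec_entry.
Qed.

Lemma monotone12 lambda : (forall i x, differentiable (u i) x) ->
  monotone1 lambda (ufield u) <-> monotone2 lambda (ufield u).
Proof.
move=> du; have duf x := differentiable_ufield (du^~ x).
split=> [mu x|mu x y].
  by apply/possemidef_symmetrizedP => w; exact: dotv_jacobian_ge.
by apply: monotone_of_jacobian => // z; exact/possemidef_symmetrizedP.
Qed.

End ufield.

(** * Borel measurability of vector-valued maps *)

Section borel_rows.
Context {R : realType}.

(** Boxes with rational centre and radius form a countable base of the
    topology of ['rV[R]_k], so the Borel sets are generated by the entries. *)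
Lemma measurable_to_borel d (S : measurableType d) k (f : S -> 'rV[R]_k) :
  (forall j, measurable_fun [set: S] (fun s => f s 0 j)) ->
  measurable_fun [set: S] (f : S -> borel R k).
Proof.
move=> mf; apply: (@measurability _ _ S (borel R k) _ _ open erefl).
move=> _ [U oU <-]; rewrite setTI.
pose box (q : 'rV[rat]_k * rat) :=
  [set x : 'rV[R]_k | forall j, ball (ratr (q.1 0 j) : R) (ratr q.2) (x 0 j)].
rewrite (_ : U =
    \bigcup_q (if pselect (box q `<=` U) then box q else set0)); last first.
  apply/seteqP; split=> [x Ux|x [q _]];
    last by case: pselect => // bU; exact: bU.
  have /nbhs_ballP[e /= e0 xeU] := open_nbhs_nbhs (conj oU Ux).
  have [r] := rat_in_itvoo (divr_gt0 e0 (ltr0Sn R 1)).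
  rewrite in_itv/= => /andP[r0 re].
  have /choice[q qP] j : exists q, ball (ratr q : R) (ratr r) (x 0 j).
    have [|q] := @rat_in_itvoo R (x 0 j - ratr r) (x 0 j + ratr r).
      by rewrite ltrBlDr -addrA ltrDl addr_gt0.
    rewrite in_itv/= => qx; exists q.
    by rewrite -ball_normE/= ltr_distl.
  exists (\row_j q j, r) => //; case: pselect => [_ /=|[]].
    by move=> j; rewrite /= mxE.
  move=> y /= yq; apply: xeU; split=> // i j; rewrite ord1.
  apply: le_ball (ball_triangle (ball_sym (qP j)) _); last first.
    by have := yq j; rewrite mxE; exact.
  by rewrite (splitr e) lerD// ltW.
rewrite preimage_bigcup; apply: countable_bigcupT_measurable => // q.
case: pselect => [?|?]; last by rewrite preimage_set0.
rewrite (_ : _ @^-1` _ = \bigcap_(j in [set: 'I_k])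
    (fun s => f s 0 j) @^-1` ball (ratr (q.1 0 j) : R) (ratr q.2)); last first.
  by apply/seteqP; split=> [s bs j _|s bs j]; exact: bs.
apply: fin_bigcap_measurable => // j _; rewrite -[X in measurable X]setTI.
exact: mf measurableT _ (measurable_ball _ _).
Qed.

Lemma measurable_continuous_borel m k (f : 'rV[R]_m -> 'rV[R]_k) :
  continuous f -> measurable_fun [set: borel R m] (f : borel R m -> borel R k).
Proof.
move=> /continuousP cf.
apply: (@measurability _ _ (borel R m) (borel R k) _ _ open erefl).
move=> _ [U oU <-].
by rewrite setTI; apply: sub_sigma_algebra; exact: cf.
Qed.

Lemma measurable_borel_set1 k (x : borel R k) : measurable [set x].
Proof.
rewrite -[X in measurable X]setCK; apply: measurableC.
apply: sub_sigma_algebra; apply: closed_openC.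
apply: (@accessible_closed_set1 'rV[R]_k); apply: hausdorff_accessible.
exact: norm_hausdorff.
Qed.

Lemma measurable_dotv d (S : measurableType d) k (f g : S -> 'rV[R]_k) :
  measurable_fun [set: S] (f : S -> borel R k) ->
  measurable_fun [set: S] (g : S -> borel R k) ->
  measurable_fun [set: S] (fun s => dotv (f s) (g s)).
Proof.
move=> mf mg; apply: measurable_sum => j; apply: measurable_funM.
  exact: (measurableT_comp (measurable_entry j) mf).
exact: (measurableT_comp (measurable_entry j) mg).
Qed.

Lemma measurable_borelB d (S : measurableType d) k (f g : S -> 'rV[R]_k) :
  measurable_fun [set: S] (f : S -> borel R k) ->
  measurable_fun [set: S] (g : S -> borel R k) ->
  measurable_fun [set: S] ((fun s => f s - g s) : S -> borel R k).
Proof.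
move=> mf mg; apply: measurable_to_borel => j.
under eq_fun do rewrite !mxE.
apply: measurable_funB.
  exact: (measurableT_comp (measurable_entry j) mf).
exact: (measurableT_comp (measurable_entry j) mg).
Qed.

End borel_rows.

(** * The product law and its boxes *)

Section product_law.
Context {I : finType} {d : I -> measure_display}.
Context {T : forall i, measurableType (d i)} {R : realType}.
Local Open Scope ereal_scope.

Definition pi_box (A : forall i, set (T i)) : set (pi_space T) :=
  [set x | forall i, A i (x i)].

Lemma pi_measurableE :
  measurable =
  <<s [set pi_box A | A in [set A | forall i, measurable (A i)]] >>.
Proof.
apply/seteqP; split; apply: smallest_sub.
- exact: smallest_sigma_algebra.
- move=> _ [i _ [A mA <-]]; apply: sub_sigma_algebra => /=.
  (* The box whose side is [A] at [i] and everything elsewhere; the transport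
     along [e : j = i] makes [A] a set of [T j]. *)
  exists (fun j => [set t | forall e : j = i, A (eq_rect _ T t _ e)]).
    move=> j; have [ji|/eqP ji] := eqVneq j i; last first.
      rewrite (_ : [set _ | _] = setT); first exact: measurableT.
      by apply/seteqP; split=> // t _ e.
    case: i / ji A mA => A mA; rewrite (_ : [set _ | _] = A)//.
    apply/seteqP; split=> t; first by move=> /(_ erefl).
    by move=> At e; rewrite (_ : e = erefl)//; exact: eq_irrelevance.
  rewrite setTI; apply/seteqP; split=> x /=; first by move=> /(_ i erefl).
  by move=> Ax j e; case: i / e A mA Ax.
- by apply: sigma_algebra_measurable.
- move=> _ [A /= mA <-].
  rewrite (_ : pi_box A =
      \bigcap_(i in [set: I]) (fun x : pi_space T => x i) @^-1` A i).
    apply: fin_bigcap_measurable => // i _; rewrite -[X in measurable X]setTI.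
    exact: measurable_coord.
  by apply/seteqP; split => [x xA i _|x xA i]; exact: xA.
Qed.

(** Boxes are stable under intersection and generate the product
    sigma-algebra, so their measure determines the product law. *)
Lemma pi_prob_unique (P : forall i, probability (T i) R)
    (mu : {measure set (pi_space T) -> \bar R}) :
  (forall A, (forall i, measurable (A i)) ->
    mu (pi_box A) = \prod_i P i (A i)) ->
  forall X, measurable X -> mu X = pi_prob P X.
Proof.
move=> muE X mX; apply/esym.
apply: (measure_unique _ (fun=> pi_box (fun=> setT)) pi_measurableE) => //.
- move=> _ _ [A mA <-] [B mB <-]; exists (fun i => A i `&` B i).
    by move=> i; exact: measurableI.
  apply/seteqP; split=> [x AB|x [xA xB] i]; last by split.
  by split=> i; have [] := AB i.
- by move=> _; exists (fun=> setT) => // i; exact: measurableT.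
- by apply/seteqP; split=> // x _; exists 0%N.
- move=> _ [A mA <-]; rewrite muE//.
  by have boxE := pi_prob_box P mA; etransitivity; [|exact: boxE].
- move=> _; rewrite (le_lt_trans (probability_le1 _ _)) ?ltry//.
  rewrite pi_measurableE; apply: sub_sigma_algebra.
  by exists (fun=> setT) => // i; exact: measurableT.
Qed.

(** The change of variables holds separately for the positive and the negative
    part of [f], hence for their difference, finite or not. *)
Lemma integral_pi_prob_law d' (S : measurableType d')
    (mu : {measure set S -> \bar R}) (phi : S -> pi_space T)
    (P : forall i, probability (T i) R) (f : pi_space T -> \bar R) :
  measurable_fun [set: S] phi ->
  (forall A, (forall i, measurable (A i)) ->
    mu (phi @^-1` pi_box A) = \prod_i P i (A i)) ->
  measurable_fun [set: pi_space T] f ->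
  \int[pi_prob P]_x f x = \int[mu]_s f (phi s).
Proof.
move=> mphi law mf.
have pos g : measurable_fun [set: pi_space T] g -> (forall x, 0 <= g x) ->
    \int[pi_prob P]_x g x = \int[mu]_s g (phi s).
  move=> mg g0.
  transitivity (\int[pushforward mu phi]_x g x).
    by apply: eq_measure_integral => A mA _; apply/esym; exact: pi_prob_unique.
  by rewrite ge0_integral_pushforward.
rewrite [LHS]integralE [RHS]integralE; congr (_ - _).
- rewrite (pos f^\+ (measurable_funepos mf) (funepos_ge0 f)).
  apply: eq_integral => s _.
  exact: esym (congr1 (fun g => g s) (funepos_comp f phi)).
- rewrite (pos f^\- (measurable_funeneg mf) (funeneg_ge0 f)).
  apply: eq_integral => s _.
  exact: esym (congr1 (fun g => g s) (funeneg_comp f phi)).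
Qed.

Lemma pi_prob_dirac (a : pi_space T) (f : pi_space T -> \bar R) :
  measurable_fun [set: pi_space T] f ->
  \int[pi_prob (fun i => dirac (a i) : probability (T i) R)]_x f x = f a.
Proof.
move=> mf; rewrite (@integral_pi_prob_law _ _ (dirac a) id)//.
  by rewrite integral_dirac// diracT mul1e.
move=> A mA; rewrite /= diracE.
have [aA|] := boolP (a \in _).
  rewrite big1// => i _; rewrite diracE mem_set//.
  by move: aA; rewrite inE; exact.
move=> /negP aA; have [i Ai] : exists i, ~ A i (a i).
  by apply/existsNP => aiA; apply: aA; rewrite inE.
by rewrite (bigD1 i)//= diracE memNset// mul0e.
Qed.

End product_law.

(** * Integrating out all coordinates but one *)

Section product_law_maps.
Context {I : finType} {d : I -> measure_display}.
Context {T : forall i, measurableType (d i)} {R : realType}.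
Local Open Scope ereal_scope.

Lemma integral_pi_prob_map (d' : I -> measure_display)
    (S : forall i, measurableType (d' i)) (h : forall i, S i -> T i)
    (Q : forall i, probability (S i) R) (P : forall i, probability (T i) R)
    (f : pi_space T -> \bar R) :
  (forall i, measurable_fun [set: S i] (h i)) ->
  (forall i A, measurable A -> Q i (h i @^-1` A) = P i A) ->
  measurable_fun [set: pi_space T] f ->
  \int[pi_prob P]_x f x = \int[pi_prob Q]_s f (fun i => h i (s i)).
Proof.
move=> mh hQ mf.
apply: (integral_pi_prob_law
  (phi := fun (s : pi_space S) i => h i (s i))) => //.
- apply: measurable_to_pi => i.
  exact: (measurableT_comp (mh i) (@measurable_coord _ _ S i)).
- move=> A mA; have mhA i : measurable (h i @^-1` A i).
    by rewrite -[X in measurable X]setTI; exact: mh.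
  have boxE := pi_prob_box Q mhA; etransitivity; first exact: boxE.
  by apply: eq_bigr => i _; rewrite hQ.
Qed.

Variable i : I.
Local Notation rest := (pi_space (fun j : {j | j != i} => T (val j))).

Lemma measurable_glue :
  measurable_fun [set: T i * rest] (fun p => Defs.glue p.1 p.2 : pi_space T).
Proof.
apply: measurable_to_pi => j; have [->|ji] := eqVneq j i.
  apply: (eq_measurable_fun fst) => [p _|]; last exact: measurable_fst.
  exact/esym/(glue_in p.1 p.2).
pose j' : {j | j != i} := exist _ j ji.
apply: (eq_measurable_fun (fun p : T i * rest => p.2 j')) => [p _|].
  exact/esym/(glue_out p.1 p.2 j').
have mj' := @measurable_coord {j | j != i} _ (fun j => T (val j)) j'.
exact: (measurableT_comp mj' measurable_snd).
Qed.

Variable P : forall i, probability (T i) R.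
Local Notation Prest := (pi_prob (fun j : {j | j != i} => P (val j))).

(** Fubini for the splitting of a point into its coordinate [i] and the others:
    boxes split as products, so drawing [t] and [w] independently and gluing
    them has the product law. *)
Lemma integral_pi_prob_glue (f : pi_space T -> \bar R) :
  measurable_fun [set: pi_space T] f -> (forall x, 0 <= f x) ->
  \int[pi_prob P]_x f x = \int[P i]_t \int[Prest]_w f (Defs.glue t w).
Proof.
move=> mf f0.
rewrite (integral_pi_prob_law (mu := (P i \x Prest)%E) measurable_glue)//.
  rewrite (@fubini_tonelli1 _ _ _ _ _ (P i) Prest
    (fun p => f (Defs.glue p.1 p.2)))//.
  exact: (measurableT_comp mf measurable_glue).
move=> A mA.
rewrite (_ : _ @^-1` _ = A i `*` pi_box (fun j : {j | j != i} => A (val j))).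
  have mbox : measurable (pi_box (fun j : {j | j != i} => A (val j))).
    rewrite pi_measurableE; apply: sub_sigma_algebra.
    by exists (fun j : {j | j != i} => A (val j)).
  have prodE := product_measure1E (P i) Prest (mA i) mbox.
  etransitivity; first exact: prodE.
  rewrite [RHS](bigD1 i)//=; congr (_ * _).
  have boxE := pi_prob_box (fun j : {j | j != i} => P (val j))
    (fun j => mA (val j)).
  etransitivity; first exact: boxE.
  rewrite [RHS](reindex_omap (val : {j | j != i} -> I) insub).
    by apply: eq_bigl => -[j ji] /=; rewrite insubT ji eqxx.
  by move=> j ji; rewrite insubT.
apply/seteqP; split=> [[t w] /= tw|[t w] /= [At Aw] j].
  split=> [|j]; first by have := tw i; rewrite (glue_in t w).
  by have := tw (val j); rewrite (glue_out t w).
have [->|ji] := eqVneq j i; first by rewrite (glue_in t w).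
pose j' : {j | j != i} := exist _ j ji.
by rewrite (glue_out t w j'); exact: (Aw j').
Qed.

Definition averaged (f : pi_space T -> \bar R) (t : T i) : \bar R :=
  \int[Prest]_w f (Defs.glue t w).

Lemma measurable_averaged (f : pi_space T -> \bar R) :
  measurable_fun [set: pi_space T] f -> (forall x, 0 <= f x) ->
  measurable_fun [set: T i] (averaged f).
Proof.
move=> mf f0.
apply: (@measurable_fun_fubini_tonelli_F _ _ _ _ _ Prest
  (fun p => f (Defs.glue p.1 p.2))) => //.
exact: (measurableT_comp mf measurable_glue).
Qed.

Lemma averaged_ge0 (f : pi_space T -> \bar R) :
  (forall x, 0 <= f x) -> forall t, 0 <= averaged f t.
Proof. by move=> f0 t; exact: integral_ge0. Qed.

Lemma integral_averaged (f : pi_space T -> \bar R) :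
  measurable_fun [set: pi_space T] f -> (forall x, 0 <= f x) ->
  \int[pi_prob P]_x averaged f (x i) = \int[pi_prob P]_x f x.
Proof.
move=> mf f0; rewrite (integral_pi_prob_glue mf f0).
apply: (ge0_integral_pi_coord P (i := i)); first exact: measurable_averaged.
exact: averaged_ge0.
Qed.

Lemma ae_pi_prob_coord (Q : T i -> Prop) :
  {ae P i, forall t, Q t} -> {ae pi_prob P, forall x, Q (x i)}.
Proof.
move=> [N [mN N0 QN]]; exists ((fun x : pi_space T => x i) @^-1` N); split.
- by rewrite -[X in measurable X]setTI; exact: measurable_coord.
- by rewrite -N0; exact: pi_prob_coord.
- by move=> x /= Qx; exact: QN.
Qed.

End product_law_maps.

Lemma ae_pi_prob_forall (I : finType) (d : I -> measure_display)
    (T : forall i, measurableType (d i)) (R : realType)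
    (P : forall i, probability (T i) R) (Q : forall i, T i -> Prop)
    (S : pi_space T -> Prop) :
  (forall i, {ae P i, forall t, Q i t}) ->
  (forall x : pi_space T, (forall i, Q i (x i)) -> S x) ->
  {ae pi_prob P, forall x, S x}.
Proof.
move=> aeQ QS; have F := ae_filter_ringOfSetsType (pi_prob P).
apply: (@filterS _ _ F _ _ QS).
by apply: (@filter_forall _ _ _ _ F) => i; exact: ae_pi_prob_coord (aeQ i).
Qed.

Section sum_averaged.
Context {I : finType} {d : I -> measure_display}.
Context {T : forall i, measurableType (d i)} {R : realType}.
Variable P : forall i, probability (T i) R.
Variable f : I -> pi_space T -> \bar R.
Hypothesis mf : forall i, measurable_fun [set: pi_space T] (f i).
Local Open Scope ereal_scope.
Hypothesis f0 : forall i x, 0 <= f i x.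

Lemma measurable_averaged_coord i :
  measurable_fun [set: pi_space T] (fun x => averaged P (f i) (x i)).
Proof.
have ma := measurable_averaged P (i := i) (mf i) (f0 i).
exact: (measurableT_comp ma (@measurable_coord _ _ T i)).
Qed.

Lemma measurable_sum_averaged :
  measurable_fun [set: pi_space T] (fun x => \sum_i averaged P (f i) (x i)).
Proof. by apply: emeasurable_sum; exact: measurable_averaged_coord. Qed.

Lemma integral_sum_averaged :
  \int[pi_prob P]_x (\sum_i averaged P (f i) (x i)) =
  \int[pi_prob P]_x (\sum_i f i x).
Proof.
rewrite [LHS]ge0_integral_sum//; last 2 first.
- exact: measurable_averaged_coord.
- by move=> i x _; exact: averaged_ge0.
rewrite [RHS]ge0_integral_sum//; apply: eq_bigr => i _.
exact: integral_averaged.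
Qed.

End sum_averaged.

(** * Comparing an integral with averaged positive and negative parts *)

Section averaged_inequality.
Local Open Scope ereal_scope.
Context d (T : measurableType d) (R : realType).

(** In the application [gp] and [gn] are the positive and negative parts of the
    pairing, and [A] and [B] their averages. The integral of [gp] may be
    infinite, so [- f] need not be the difference of two integrable functions.
    The relation [f + A = B] is therefore integrated in the form
    [f^\+ + A = f^\- + B], which gives [balance]. Since [f^\+ <= B], the
    integrals of [f^\+] and [gn] are finite, and these are the only ones that
    have to be cancelled. *)
Lemma le_integral_averaged (mu : {measure set T -> \bar R}) (lambda : R)
    (s f : T -> R) (gp gn A B : T -> \bar R) :
  measurable_fun [set: T] s -> measurable_fun [set: T] f ->
  measurable_fun [set: T] gp -> measurable_fun [set: T] gn ->
  measurable_fun [set: T] A -> measurable_fun [set: T] B ->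
  (forall x, 0 <= s x)%R -> (forall x, 0 <= gp x) -> (forall x, 0 <= gn x) ->
  (forall x, 0 <= A x) -> (forall x, 0 <= B x) ->
  (forall x, (lambda * s x)%:E + gn x <= gp x) ->
  \int[mu]_x gn x < +oo ->
  \int[mu]_x A x = \int[mu]_x gp x -> \int[mu]_x B x = \int[mu]_x gn x ->
  {ae mu, forall x, [/\ A x \is a fin_num, B x \is a fin_num &
    (f x)%:E + A x = B x]} ->
  lambda%:E * \int[mu]_x (s x)%:E <= - \int[mu]_x (f x)%:E.
Proof.
move=> ms mf mgp mgn mA mB s0 gp0 gn0 A0 B0 gle gnoo AE BE fAB.
pose F x := (f x)%:E.
have mF : measurable_fun [set: T] F by exact/measurable_EFinP.
have mFp := measurable_funepos mF; have mFn := measurable_funeneg mF.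
have msE : measurable_fun [set: T] (EFin \o s) by exact/measurable_EFinP.
have balance : \int[mu]_x F^\+ x + \int[mu]_x gp x =
    \int[mu]_x F^\- x + \int[mu]_x gn x.
  rewrite -AE -BE -!ge0_integralD//.
  apply: ge0_ae_eq_integral => //.
  - exact: emeasurable_funD.
  - exact: emeasurable_funD.
  - by move=> x _; rewrite adde_ge0.
  - by move=> x _; rewrite adde_ge0.
  apply: filterS fAB => x [Afin Bfin fABx] _.
  rewrite -fABx -(fineK Afin) funeposE funenegE /F -EFin_max -EFinN -EFin_max.
  rewrite -!EFinD; congr EFin.
  by case: (lerP (f x) 0) => fx;
    [rewrite max_l ?oppr_ge0//|rewrite max_r ?oppr_le0 ?(ltW fx)//]; ring.
have Fp_fin : \int[mu]_x F^\+ x \is a fin_num.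
  rewrite ge0_fin_numE ?integral_ge0//; apply: le_lt_trans gnoo; rewrite -BE.
  apply: ae_ge0_le_integral => //.
  apply: filterS fAB => x [Afin Bfin fABx] _.
  rewrite funeposE /F -EFin_max -fABx -(fineK Afin) -EFinD lee_fin ge_max.
  have := A0 x; have := B0 x; rewrite -fABx -(fineK Afin) -EFinD !lee_fin.
  by move=> -> a0; rewrite lerDl a0.
have gn_fin : \int[mu]_x gn x \is a fin_num.
  by rewrite ge0_fin_numE ?integral_ge0.
have S0 : 0 <= \int[mu]_x (s x)%:E.
  by apply: integral_ge0 => x _; rewrite lee_fin.
rewrite [in leRHS]integralE -/F oppeB ?fin_num_adde_defr// addeC.
have [l0|l0] := leP 0%R lambda.
  rewrite leeBrDr// -(leeD2rE _ _ gn_fin) -balance addeAC [leRHS]addeC leeD2r//.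
  rewrite -ge0_integralZl//; last by move=> x _; rewrite lee_fin.
  rewrite -ge0_integralD//.
  - apply: ge0_le_integral => //.
    + by move=> x _; rewrite adde_ge0// lee_fin mulr_ge0.
    + by apply: emeasurable_funD => //; exact: measurable_funeM.
    + by move=> x _; rewrite -EFinM.
  - by move=> x _; rewrite mule_ge0// lee_fin.
  - exact: measurable_funeM.
(* For [lambda < 0] the term in [s] goes to the other side; its integral may
   be infinite, and then the left-hand side is [-oo]. *)
have [->|Soo] := eqVneq (\int[mu]_x (s x)%:E) +oo.
  by rewrite lt0_muley ?lte_fin// leNye.
have Sfin : \int[mu]_x (s x)%:E \is a fin_num by rewrite ge0_fin_numE// ltey.
have gle' : \int[mu]_x gn x <=
    (- lambda)%:E * \int[mu]_x (s x)%:E + \int[mu]_x gp x.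
  have nl0 : (0 <= - lambda)%R by rewrite oppr_ge0 ltW.
  rewrite -ge0_integralZl//; last by move=> x _; rewrite lee_fin.
  rewrite -ge0_integralD//.
  - apply: ge0_le_integral => //.
    + by apply: emeasurable_funD => //; exact: measurable_funeM.
    + by move=> x _; rewrite -EFinM mulNr EFinN addeC leeBrDr// addeC.
  - by move=> x _; rewrite mule_ge0// lee_fin.
  - exact: measurable_funeM.
have Kfin : lambda%:E * \int[mu]_x (s x)%:E \is a fin_num by rewrite fin_numM.
rewrite leeBrDr// -(leeD2rE _ _ gn_fin) -balance.
move: gle'; rewrite EFinN mulNe [X in _ <= X]addeC leeBrDr// => gle'.
by rewrite -addeA addeCA leeD2l// addeC.
Qed.

End averaged_inequality.

(** * Integrals of vector-valued functions *)

Section integral_dotv.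
Context d (T : measurableType d) (R : realType).
Variable mu : {measure set T -> \bar R}.
Local Open Scope ereal_scope.

Lemma integral_finite_sum (I : Type) (s : seq I) (h : I -> T -> \bar R) :
  (forall i, mu.-integrable setT (h i)) ->
  \int[mu]_x (\sum_(i <- s) h i x) = \sum_(i <- s) \int[mu]_x h i x.
Proof.
move=> ih; elim: s => [|i s IH].
  by under eq_integral do rewrite big_nil; rewrite integral0 big_nil.
under eq_integral do rewrite big_cons.
by rewrite integralD//= ?IH ?big_cons//; exact: integrable_sum.
Qed.

Lemma integrable_balance (g : T -> \bar R) (v : R) :
  mu.-integrable setT g -> v%:E = - (\int[mu]_x g x) ->
  [/\ (\int[mu]_x g^\+ x) \is a fin_num, (\int[mu]_x g^\- x) \is a fin_num &
      v%:E + \int[mu]_x g^\+ x = \int[mu]_x g^\- x].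
Proof.
move=> ig ->.
have fp : (\int[mu]_x g^\+ x) \is a fin_num.
  exact/integrable_fin_num/integrable_funepos.
have fn : (\int[mu]_x g^\- x) \is a fin_num.
  exact/integrable_fin_num/integrable_funeneg.
split=> //.
rewrite [in LHS]integralE fin_num_oppeB// addeAC.
by rewrite [X in X + _]addeC subee// add0e.
Qed.

Lemma integral_dotv k (c : 'rV[R]_k) (a : T -> 'rV[R]_k) :
  (forall j, mu.-integrable setT (fun t => (a t 0%R j)%:E)) ->
  mu.-integrable setT (fun t => (dotv c (a t))%:E) /\
  \int[mu]_t (dotv c (a t))%:E =
    (dotv c (\row_j fine (\int[mu]_t (a t 0%R j)%:E)))%:E.
Proof.
move=> ia.
have ica j : mu.-integrable setT (fun t => (c 0%R j)%:E * (a t 0%R j)%:E).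
  exact: integrableZl.
have E t : (dotv c (a t))%:E = \sum_j (c 0%R j)%:E * (a t 0%R j)%:E.
  by rewrite /dotv -sumEFin.
split; first by under eq_fun do rewrite E; exact: integrable_sum.
under eq_integral do rewrite E.
rewrite integral_finite_sum// /dotv -sumEFin; apply: eq_bigr => j _.
by rewrite integralZl// mxE EFinM fineK// integrable_fin_num.
Qed.

Lemma integral_dotvB k (c : 'rV[R]_k) (a b : T -> 'rV[R]_k) :
  (forall j, mu.-integrable setT (fun t => (a t 0%R j)%:E)) ->
  (forall j, mu.-integrable setT (fun t => (b t 0%R j)%:E)) ->
  mu.-integrable setT (fun t => (dotv c (a t - b t))%:E) /\
  \int[mu]_t (dotv c (a t - b t))%:E =
    (dotv c (\row_j fine (\int[mu]_t (a t 0%R j)%:E) -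
             \row_j fine (\int[mu]_t (b t 0%R j)%:E)))%:E.
Proof.
move=> ia ib.
have iab j : mu.-integrable setT (fun t => ((a t - b t) 0%R j)%:E).
  by under eq_fun do rewrite !mxE EFinB; exact: integrableB.
have [i ->] := integral_dotv c iab; split=> //; congr (dotv _ _)%:E.
apply/rowP => j; rewrite !mxE.
under eq_integral do rewrite !mxE EFinB.
by rewrite integralB// fineB// integrable_fin_num.
Qed.

End integral_dotv.

Section parametric_integral.
Context d1 d2 (T1 : measurableType d1) (T2 : measurableType d2) (R : realType).
Local Open Scope ereal_scope.

Lemma measurable_parametric_integral (m : probability T2 R)
    (f : T1 * T2 -> R) : measurable_fun [set: T1 * T2] f ->
  measurable_fun [set: T1] (fun x => fine (\int[m]_y (f (x, y))%:E)).
Proof.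
move=> mf; apply: (measurableT_comp (fine_measurable measurableT)).
pose F := EFin \o f.
have mF : measurable_fun [set: T1 * T2] F by exact/measurable_EFinP.
apply: (eq_measurable_fun
  (fun x => \int[m]_y F^\+ (x, y) - \int[m]_y F^\- (x, y))) => [x _|].
  rewrite [RHS]integralE; congr (_ - _); apply: eq_integral => y _.
    exact: esym (congr1 (fun g => g y) (funepos_comp F (fun y => (x, y)))).
  exact: esym (congr1 (fun g => g y) (funeneg_comp F (fun y => (x, y)))).
apply: emeasurable_funB.
- apply: (@measurable_fun_fubini_tonelli_F _ _ _ _ _ m F^\+) => //.
  exact: measurable_funepos.
- apply: (@measurable_fun_fubini_tonelli_F _ _ _ _ _ m F^\-) => //.
  exact: measurable_funeneg.
Qed.

End parametric_integral.

(** * Measurability of the velocity field *)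

Lemma glue_map (I : finType) (T S : I -> Type) (h : forall j, T j -> S j)
    (i : I) (t : T i) (w : forall j : {j | j != i}, T (val j)) j :
  h j (Defs.glue t w j) = Defs.glue (h i t) (fun j => h (val j) (w j)) j.
Proof.
have [->|ji] := eqVneq j i; first by rewrite (glue_in t w) glue_in.
pose j' : {j | j != i} := exist _ j ji.
by rewrite (glue_out t w j') (glue_out (h i t) _ j').
Qed.

Lemma glue_self (I : finType) (T : I -> Type) (i : I) (x : forall j, T j) :
  Defs.glue (x i) (fun j : {j | j != i} => x (val j)) = x.
Proof.
apply/functional_extensionality_dep => j.
have [->|ji] := eqVneq j i; first exact: glue_in.
exact: (glue_out (x i) _ (exist _ j ji)).
Qed.

Section velocity_field.
Context {R : realType} {n : nat} (dim : 'I_n -> nat).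
Local Notation D := (\sum_(i < n) dim i)%N.
Variable u : forall i, 'rV[R]_D -> 'rV[R]_(dim i).
Hypothesis cu : forall i, continuous (u i).

Local Notation pair_type := (fun i => (borel R (dim i) * borel R (dim i))%type).
Local Notation pair_space := (pi_space pair_type).

Lemma measurable_vec d (S : measurableType d)
    (f : S -> forall i, 'rV[R]_(dim i)) :
  (forall i,
    measurable_fun [set: S] ((fun s => f s i) : S -> borel R (dim i))) ->
  measurable_fun [set: S] ((fun s => vec (f s)) : S -> borel R D).
Proof.
move=> mf; apply: measurable_to_borel => j.
under eq_fun do rewrite vec_entry.
exact: (measurableT_comp (measurable_entry (tagnat.sig2 j))
  (mf (tagnat.sig1 j))).
Qed.

Lemma measurable_xs :
  measurable_fun [set: pair_space] (@xs R n dim : pair_space -> borel R D).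
Proof.
apply: measurable_vec => i.
exact: (measurableT_comp measurable_fst (@measurable_coord _ _ pair_type i)).
Qed.

Lemma measurable_ys :
  measurable_fun [set: pair_space] (@ys R n dim : pair_space -> borel R D).
Proof.
apply: measurable_vec => i.
exact: (measurableT_comp measurable_snd (@measurable_coord _ _ pair_type i)).
Qed.

Lemma measurable_pairing i : measurable_fun [set: pair_space] (pairing u i).
Proof.
have mc := @measurable_coord _ _ pair_type i.
have mui := measurable_continuous_borel (@cu i).
apply: measurable_dotv; apply: measurable_borelB.
- exact: (measurableT_comp measurable_fst mc).
- exact: (measurableT_comp measurable_snd mc).
- exact: (measurableT_comp mui measurable_xs).
- exact: (measurableT_comp mui measurable_ys).
Qed.

Lemma measurable_slice i :
  measurable_fun [set: borel R (dim i) *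
      pi_space (fun j : {j | j != i} => borel R (dim (val j)))]
    ((fun p => Defs.slice u p.1 p.2) : _ -> borel R (dim i)).
Proof.
have mg := @measurable_glue _ _ (fun j => borel R (dim j)) i.
have mv := measurable_vec (fun j => measurableT_comp
  (@measurable_coord _ _ (fun j => borel R (dim j)) j) mg).
exact: (measurableT_comp (measurable_continuous_borel (@cu i)) mv).
Qed.

Lemma measurable_velocity_comp
    (rho : forall i, probability (borel R (dim i)) R) i :
  measurable_fun [set: borel R (dim i)]
    (velocity_comp u rho (i := i) : borel R (dim i) -> borel R (dim i)).
Proof.
apply: measurable_to_borel => k.
under eq_fun do rewrite mxE.
apply: measurable_funN.
apply: (measurable_parametric_integral (rho_minus rho i)
  (f := fun p => Defs.slice u p.1 p.2 0 k)).
exact: (measurableT_comp (measurable_entry k) (@measurable_slice i)).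
Qed.

End velocity_field.

(** * The velocity field under a product of couplings *)

Section velocity_pairing.
Context {R : realType} {n : nat} (dim : 'I_n -> nat).
Local Notation D := (\sum_(i < n) dim i)%N.
Variable u : forall i, 'rV[R]_D -> 'rV[R]_(dim i).

Local Notation pair_type := (fun i => (borel R (dim i) * borel R (dim i))%type).
Local Notation pair_space := (pi_space pair_type).

Lemma pairing_glue i (p : 'rV[R]_(dim i) * 'rV[R]_(dim i))
    (w : forall j : {j | j != i}, 'rV[R]_(dim (val j)) * 'rV[R]_(dim (val j))) :
  pairing u i (Defs.glue (T := pair_type) p w) =
  dotv (p.1 - p.2) (Defs.slice u p.1 (fun j => (w j).1) -
                    Defs.slice u p.2 (fun j => (w j).2)).
Proof.
rewrite /pairing (glue_in (T := pair_type) p w); congr (dotv _ (_ - _)).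
  rewrite /Defs.slice /xs; congr (u _ (vec _)).
  apply/functional_extensionality_dep => j.
  exact: (glue_map (fun j (q : pair_type j) => q.1 : 'rV[R]_(dim j))).
rewrite /Defs.slice /ys; congr (u _ (vec _)).
apply/functional_extensionality_dep => j.
exact: (glue_map (fun j (q : pair_type j) => q.2 : 'rV[R]_(dim j))).
Qed.

Variables rho0 rho1 : forall i, probability (borel R (dim i)) R.
Variable gamma :
  forall i, probability (borel R (dim i) * borel R (dim i))%type R.
Hypothesis cg : forall i, coupling (rho0 i) (rho1 i) (gamma i).

Definition gamma_minus i := pi_prob (fun j : {j | j != i} => gamma (val j)).

(** The projections of the couplings on the two marginals are treated at once:
    [h] is [fst] and [rho] is [rho0], or [h] is [snd] and [rho] is [rho1]. *)
Lemma slice_marginal (rho : forall i, probability (borel R (dim i)) R)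
    (h : forall j, pair_type j -> borel R (dim j)) i xi :
  (forall j, measurable_fun [set: pair_type j] (h j)) ->
  (forall j A, measurable A -> gamma j (h j @^-1` A) = rho j A) ->
  (forall k, (rho_minus rho i).-integrable setT
    (fun z => (Defs.slice u xi z 0 k)%:E)) ->
  let b w : 'rV[R]_(dim i) := Defs.slice u xi (fun j => h (val j) (w j)) in
  (forall k, (gamma_minus i).-integrable setT (fun w => (b w 0 k)%:E)) /\
  velocity_comp u rho xi =
    - \row_k fine (\int[gamma_minus i]_w (b w 0 k)%:E)%E.
Proof.
move=> mh hg irho b.
have mslice k := measurable_int _ (irho k).
have map_int
    (f : pi_space (fun j : {j | j != i} => borel R (dim (val j))) -> \bar R) :
    measurable_fun setT f ->
    (\int[rho_minus rho i]_z f z =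
     \int[gamma_minus i]_w f (fun j => h (val j) (w j)))%E.
  move=> mf; apply: (integral_pi_prob_map
    (h := fun j : {j | j != i} => h (val j))) => //.
  by move=> j A mA; exact: hg.
split=> [k|].
  apply/integrableP; split.
    apply: (measurableT_comp (mslice k)).
    apply: measurable_to_pi => j.
    exact: (measurableT_comp (mh (val j))
      (@measurable_coord _ _ (fun j : {j | j != i} => pair_type (val j)) j)).
  have /integrableP[_] := irho k.
  by rewrite map_int//; exact: measurableT_comp.
apply/rowP => k; rewrite !mxE /Rintegral; congr (- fine _).
exact: map_int.
Qed.

Definition velocity_pairing i (p : pair_type i) : R :=
  dotv (p.1 - p.2) (velocity_comp u rho0 p.1 - velocity_comp u rho1 p.2).

(** For almost every pair [p] the integrals defining both velocities converge
    absolutely, so averaging the pairing over the other coordinates commutes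
    with the difference and the dot product: the average is finite and equal to
    [- velocity_pairing p], and it is also the difference of the averaged
    positive and negative parts. *)
Lemma velocity_pairing_averaged i :
  velocity_defined u rho0 -> velocity_defined u rho1 ->
  {ae gamma i, forall p,
    let A := averaged gamma (fun z => (pairing u i z)%:E)^\+%E p in
    let B := averaged gamma (fun z => (pairing u i z)%:E)^\-%E p in
    [/\ A \is a fin_num, B \is a fin_num &
        ((velocity_pairing p)%:E + A = B)%E]}.
Proof.
move=> /(_ i) d0 /(_ i) d1.
have {}d0 : {ae gamma i, forall p : pair_type i, forall k,
    (rho_minus rho0 i).-integrable setT
      (fun z => (Defs.slice u p.1 z 0 k)%:E)}.
  case: d0 => N [mN N0 sN]; exists (fst @^-1` N); split.
  - by rewrite -[X in measurable X]setTI; exact: measurable_fst.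
  - by rewrite (cg i).1.
  - by move=> p; exact: sN.
have {}d1 : {ae gamma i, forall p : pair_type i, forall k,
    (rho_minus rho1 i).-integrable setT
      (fun z => (Defs.slice u p.2 z 0 k)%:E)}.
  case: d1 => N [mN N0 sN]; exists (snd @^-1` N); split.
  - by rewrite -[X in measurable X]setTI; exact: measurable_snd.
  - by rewrite (cg i).2.
  - by move=> p; exact: sN.
apply: filterS2 d0 d1 => p d0 d1 /=.
pose a (w : forall j : {j | j != i}, pair_type (val j)) : 'rV[R]_(dim i) :=
  Defs.slice u p.1 (fun j => (w j).1).
pose b (w : forall j : {j | j != i}, pair_type (val j)) : 'rV[R]_(dim i) :=
  Defs.slice u p.2 (fun j => (w j).2).
have [i0 v0] : (forall k, (gamma_minus i).-integrable setT
    (fun w => (a w 0 k)%:E)) /\ velocity_comp u rho0 p.1 =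
    - \row_k fine (\int[gamma_minus i]_w (a w 0 k)%:E)%E.
  exact: (slice_marginal (h := fun j (q : pair_type j) => q.1)
    (fun j => measurable_fst) (fun j => (cg j).1) d0).
have [i1 v1] : (forall k, (gamma_minus i).-integrable setT
    (fun w => (b w 0 k)%:E)) /\ velocity_comp u rho1 p.2 =
    - \row_k fine (\int[gamma_minus i]_w (b w 0 k)%:E)%E.
  exact: (slice_marginal (h := fun j (q : pair_type j) => q.2)
    (fun j => measurable_snd) (fun j => (cg j).2) d1).
pose g w := (pairing u i (Defs.glue (T := pair_type) p w))%:E.
have [ig Ig] := integral_dotvB (p.1 - p.2) i0 i1.
have gE : g = fun w => (dotv (p.1 - p.2) (a w - b w))%:E.
  by apply/funext => w; rewrite /g pairing_glue.
rewrite -gE in ig Ig.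
have posE : averaged gamma (fun z => (pairing u i z)%:E)^\+%E p =
    (\int[gamma_minus i]_w g^\+ w)%E.
  apply: eq_integral => w _.
  exact: esym (congr1 (fun f => f w)
    (funepos_comp _ (Defs.glue (T := pair_type) p))).
have negE : averaged gamma (fun z => (pairing u i z)%:E)^\-%E p =
    (\int[gamma_minus i]_w g^\- w)%E.
  apply: eq_integral => w _.
  exact: esym (congr1 (fun f => f w)
    (funeneg_comp _ (Defs.glue (T := pair_type) p))).
rewrite posE negE; apply: integrable_balance => //.
rewrite Ig -EFinN /velocity_pairing v0 v1 -dotvNr; congr (dotv _ _)%:E.
by rewrite opprB opprK addrC.
Qed.

End velocity_pairing.

(** * From the finite-dimensional inequality to the velocity field *)

Section finite_dimensional_to_wasserstein.
Context {R : realType} {n : nat} (dim : 'I_n -> nat).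
Local Notation D := (\sum_(i < n) dim i)%N.
Variable u : forall i, 'rV[R]_D -> 'rV[R]_(dim i).
Hypothesis cu : forall i, continuous (u i).

Local Notation pair_type := (fun i => (borel R (dim i) * borel R (dim i))%type).
Local Notation pair_space := (pi_space pair_type).

Lemma dotv_velocity (rho0 rho1 : forall i, probability (borel R (dim i)) R)
    (z : pair_space) :
  dotv (xs z - ys z) (velocity u rho0 (xs z) - velocity u rho1 (ys z)) =
  \sum_i velocity_pairing u rho0 rho1 (z i).
Proof.
rewrite /velocity /xs /ys !vecB dotv_vec; apply: eq_bigr => i _.
by rewrite /vec !mxrowK.
Qed.

Lemma dotv_ufield (z : pair_space) :
  dotv (ufield u (xs z) - ufield u (ys z)) (xs z - ys z) =
  \sum_i pairing u i z.
Proof.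
rewrite dotvC /ufield {1}/xs {1}/ys !vecB dotv_vec.
by apply: eq_bigr => i _.
Qed.

Lemma measurable_velocity_pairing
    (rho0 rho1 : forall i, probability (borel R (dim i)) R) i :
  measurable_fun [set: pair_type i] (velocity_pairing u rho0 rho1 (i := i)).
Proof.
apply: measurable_dotv; apply: measurable_borelB.
- exact: measurable_fst.
- exact: measurable_snd.
- exact: (measurableT_comp (measurable_velocity_comp cu rho0 (i := i))
    measurable_fst).
- exact: (measurableT_comp (measurable_velocity_comp cu rho1 (i := i))
    measurable_snd).
Qed.

Lemma measurable_dotv_velocity
    (rho0 rho1 : forall i, probability (borel R (dim i)) R) :
  measurable_fun [set: pair_space] (fun z : pair_space =>
    dotv (xs z - ys z) (velocity u rho0 (xs z) - velocity u rho1 (ys z))).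
Proof.
rewrite (funext (dotv_velocity rho0 rho1)); apply: measurable_sum => i.
exact: (measurableT_comp (measurable_velocity_pairing rho0 rho1 (i := i))
  (@measurable_coord _ _ pair_type i)).
Qed.

Lemma velocity_monotone_of_monotone1 lambda :
  monotone1 lambda (ufield u) -> velocity_monotone u lambda.
Proof.
move=> mono rho0 rho1 gamma _ _ d0 d1 og pd.
pose g i (z : pair_space) := (pairing u i z)%:E.
have mg i : measurable_fun [set: pair_space] (g i).
  by apply/measurable_EFinP; exact: measurable_pairing.
have mgp i := measurable_funepos (mg i).
have mgn i := measurable_funeneg (mg i).
have gp0 i z : (0 <= (g i)^\+ z)%E := funepos_ge0 _ _.
have gn0 i z : (0 <= (g i)^\- z)%E := funeneg_ge0 _ _.
apply: (le_integral_averaged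
  (gp := fun z => (\sum_i (g i)^\+ z)%E) (gn := fun z => (\sum_i (g i)^\- z)%E)
  (A := fun z => (\sum_i averaged gamma (g i)^\+%E (z i))%E)
  (B := fun z => (\sum_i averaged gamma (g i)^\-%E (z i))%E)).
- have md :=
    measurable_borelB (@measurable_xs R n dim) (@measurable_ys R n dim).
  exact: measurable_dotv.
- exact: measurable_dotv_velocity.
- exact: emeasurable_sum.
- exact: emeasurable_sum.
- exact: measurable_sum_averaged.
- exact: measurable_sum_averaged.
- by move=> z; exact: sqnorm_ge0.
- by move=> z; exact: sume_ge0.
- by move=> z; exact: sume_ge0.
- by move=> z; apply: sume_ge0 => i _; exact: (averaged_ge0 gamma (gp0 i)).
- by move=> z; apply: sume_ge0 => i _; exact: (averaged_ge0 gamma (gn0 i)).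
- move=> z; have := mono (xs z) (ys z); rewrite dotv_ufield => le_mono.
  have -> : (\sum_i (g i)^\- z = (\sum_i Num.max (- pairing u i z) 0)%:E)%E.
    rewrite -sumEFin; apply: eq_bigr => i _.
    by rewrite funenegE /g -EFinN EFin_max.
  have -> : (\sum_i (g i)^\+ z = (\sum_i Num.max (pairing u i z) 0)%:E)%E.
    by rewrite -sumEFin; apply: eq_bigr => i _; rewrite funeposE /g EFin_max.
  rewrite -EFinD lee_fin -lerBrDr -sumrB; apply: le_trans le_mono _.
  apply: ler_sum => i _.
  by case: (lerP (pairing u i z) 0) => pz;
    [rewrite max_l ?oppr_ge0//|rewrite max_r ?oppr_le0 ?(ltW pz)//]; lra.
- rewrite ge0_integral_sum//; apply: lte_sum_pinfty => i _; exact: pd.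
- exact: (integral_sum_averaged gamma mgp gp0).
- exact: (integral_sum_averaged gamma mgn gn0).
have cg i : coupling (rho0 i) (rho1 i) (gamma i) by have [] := og i.
apply: (ae_pi_prob_forall (fun i => @velocity_pairing_averaged _ _ _ _
  _ _ _ cg i d0 d1)) => z zP.
split.
- by apply/sum_fin_numP => i _ _; have [] := zP i.
- by apply/sum_fin_numP => i _ _; have [] := zP i.
rewrite dotv_velocity -sumEFin -big_split; apply: eq_bigr => i _.
by have [] := zP i.
Qed.

End finite_dimensional_to_wasserstein.

(** * Dirac masses *)

Section dirac_coupling.
Context {R : realType} {k : nat}.
Variables x y : borel R k.
Local Notation dx := (dirac x : probability (borel R k) R).
Local Notation dy := (dirac y : probability (borel R k) R).
Local Notation dxy :=
  (dirac (x, y) : probability (borel R k * borel R k)%type R).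

(** Every coupling of two Dirac masses is concentrated at the pair of their
    supports. *)
Lemma transport_cost_dirac gamma : coupling dx dy gamma ->
  transport_cost gamma = (sqnorm ((x : 'rV[R]_k) - y))%:E.
Proof.
move=> [gx gy]; rewrite /transport_cost.
have mC (t : borel R k) : measurable (~` [set t]).
  by apply: measurableC; exact: measurable_borel_set1.
have null_fst : gamma (fst @^-1` ~` [set x]) = 0%E.
  rewrite gx; last exact: mC.
  by rewrite /= diracE memNset// => /(_ erefl).
have null_snd : gamma (snd @^-1` ~` [set y]) = 0%E.
  rewrite gy; last exact: mC.
  by rewrite /= diracE memNset// => /(_ erefl).
have ae_fst : {ae gamma, forall p, p.1 = x}.
  exists (fst @^-1` ~` [set x]); split=> //.
  rewrite -[X in measurable X]setTI.
  exact: (measurable_fst measurableT _ (mC x)).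
have ae_snd : {ae gamma, forall p, p.2 = y}.
  exists (snd @^-1` ~` [set y]); split=> //.
  rewrite -[X in measurable X]setTI.
  exact: (measurable_snd measurableT _ (mC y)).
rewrite (@ge0_ae_eq_integral _ _ _ gamma setT _
  (cst (sqnorm ((x : 'rV[R]_k) - y))%:E)) //.
- by rewrite integral_cst// [X in (_ * X)%E](probability_setT gamma) mule1.
- exact: measurable_sqdist.
- by move=> p _; rewrite lee_fin sqnorm_ge0.
- by move=> p _; rewrite lee_fin sqnorm_ge0.
have F := ae_filter_ringOfSetsType gamma.
by apply: (@filterS2 _ _ F _ _ _ _ ae_fst ae_snd) => p -> ->.
Qed.

Lemma optimal_coupling_dirac : optimal_coupling dx dy dxy.
Proof.
have cxy : coupling dx dy dxy by split.
split=> //; apply/eqP; rewrite eq_le; apply/andP; split.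
  apply: le_ereal_inf_tmp => _ [gamma cgamma <-].
  by rewrite !transport_cost_dirac.
by apply: ereal_inf_lbound; exists dxy.
Qed.

Lemma finite_second_moment_dirac : finite_second_moment dx.
Proof.
rewrite /finite_second_moment integral_dirac//.
  by rewrite diracT mul1e ltry.
apply/measurable_EFinP; apply: measurable_dotv; exact: measurable_id.
Qed.

End dirac_coupling.

(** * From the velocity field to the finite-dimensional inequality *)

Section wasserstein_to_finite_dimensional.
Context {R : realType} {n : nat} (dim : 'I_n -> nat).
Local Notation D := (\sum_(i < n) dim i)%N.
Variable u : forall i, 'rV[R]_D -> 'rV[R]_(dim i).
Hypothesis cu : forall i, continuous (u i).

Local Notation pair_type := (fun i => (borel R (dim i) * borel R (dim i))%type).
Local Notation pair_space := (pi_space pair_type).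

Section dirac.
Variable x : 'rV[R]_D.
Definition dirac_profile i : probability (borel R (dim i)) R :=
  dirac (submxrow x i : borel R (dim i)).

Lemma integral_rho_minus_dirac i f :
  measurable_fun
    [set: pi_space (fun j : {j | j != i} => borel R (dim (val j)))] f ->
  (\int[rho_minus dirac_profile i]_z f z = f (fun j => submxrow x (val j)))%E.
Proof. exact: pi_prob_dirac. Qed.

Lemma measurable_slice_entry i (xi : 'rV[R]_(dim i)) k : measurable_fun
    [set: pi_space (fun j : {j | j != i} => borel R (dim (val j)))]
    (fun z => (Defs.slice u xi z 0 k)%:E).
Proof.
apply/measurable_EFinP.
have mp := measurable_pair1 (xi : borel R (dim i)).
exact: (measurableT_comp (measurable_entry k)
  (measurableT_comp (measurable_slice cu (i := i)) (mp _ _))).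
Qed.

Lemma velocity_defined_dirac : velocity_defined u dirac_profile.
Proof.
move=> i; apply: aeW => xi k; apply/integrableP; split.
  exact: measurable_slice_entry.
rewrite integral_rho_minus_dirac ?ltry//.
exact: measurableT_comp (measurable_slice_entry _ _).
Qed.

Lemma velocity_dirac : velocity u dirac_profile x = - ufield u x.
Proof.
apply/rowP => j; rewrite [RHS]mxE /velocity /ufield !vec_entry.
set i := tagnat.sig1 j; rewrite mxE /Rintegral.
rewrite integral_rho_minus_dirac; last exact: measurable_slice_entry.
rewrite /= /Defs.slice (glue_self i (submxrow x)).
by rewrite /vec submxrowK.
Qed.

End dirac.

Lemma monotone1_of_velocity_monotone lambda :
  velocity_monotone u lambda -> monotone1 lambda (ufield u).
Proof.
move=> mono x y.
pose z : pair_space := fun i => (submxrow x i, submxrow y i).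
pose gamma i : probability (borel R (dim i) * borel R (dim i))%type R :=
  dirac (z i).
have xz : xs z = x by exact: submxrowK.
have yz : ys z = y by exact: submxrowK.
have integral_gamma f : measurable_fun [set: pair_space] f ->
    (\int[pi_prob gamma]_s f s = f z)%E by exact: pi_prob_dirac.
have md := measurable_borelB (@measurable_xs R n dim) (@measurable_ys R n dim).
have := mono (dirac_profile x) (dirac_profile y) gamma.
rewrite !integral_gamma; last 2 first.
- by apply/measurable_EFinP; exact: measurable_dotv_velocity.
- by apply/measurable_EFinP; exact: (measurable_dotv md md).
rewrite xz yz !velocity_dirac -EFinM -EFinN lee_fin.
rewrite -dotvNr opprB opprK [X in dotv _ X]addrC [leRHS]dotvC; apply.
- by move=> i; exact: finite_second_moment_dirac.
- by move=> i; exact: finite_second_moment_dirac.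
- exact: velocity_defined_dirac.
- exact: velocity_defined_dirac.
- by move=> i; exact: optimal_coupling_dirac.
- move=> i; rewrite integral_gamma; last first.
    apply: measurable_funeneg; apply/measurable_EFinP.
    exact: measurable_pairing.
  by rewrite funenegE -EFinN -EFin_max ltry.
Qed.

End wasserstein_to_finite_dimensional.

Unset Implicit Arguments.

Theorem proposition1p5 (R : realType) (n : nat) (dim : 'I_n -> nat)
    (lambda : R)
    (u : forall i : 'I_n,
      'rV[R]_((\sum_(j < n) dim j)%N) -> 'rV[R]_(dim i)) :
  (0 < n)%N -> (forall i, (0 < dim i)%N) ->
  (forall i, C1 (u i)) ->
  (monotone1 lambda (ufield u) <-> velocity_monotone u lambda) /\
  (monotone2 lambda (ufield u) <-> velocity_monotone u lambda).
Proof.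
move=> _ _ C1u.
have du i x : differentiable (u i) x := (C1u i).1 x.
have cu i : continuous (u i).
  by move=> x; exact: differentiable_continuous (du i x).
have mono : monotone1 lambda (ufield u) <-> velocity_monotone u lambda.
  split; first exact: velocity_monotone_of_monotone1.
  exact: monotone1_of_velocity_monotone.
split=> //; exact: iff_trans (iff_sym (monotone12 lambda du)) mono.
Qed.
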